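(* Let $S^4$ be the round unit $4$-sphere (constant curvature $\kappa=1$), let $N\subset S^4$ be a $3$-dimensional geodesic sphere which is not a great sphere, and let $v$ be a smooth bifoliating unit vector field on $N$. Then the $1$-form $\alpha=\langle v,\cdot\rangle$ on $N$ dual to $v$ is a contact form (i.e. $\alpha\wedge d\alpha$ vanishes nowhere).
   Context: Let $U\subset S^4$ be the exterior of $N$, i.e. the open zone between $N$ and its antipodal image $-N$. For $u\in TS^4$, $\gamma_u$ denotes the geodesic of $S^4$ with initial velocity $u$. A smooth unit (tangent) vector field $v$ on $N$ is bifoliating if the geodesic rays $\gamma_{v(p)}(0,\pi)$, $p\in N$, are the leaves of a smooth foliation of $U$, and likewise the rays $\gamma_{-v(p)}(0,\pi)$, $p\in N$, are the leaves of a smooth foliation of $U$. *)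

(* Defs.v *)
From HB Require Import structures.
From mathcomp Require Import all_boot all_order all_algebra.
From mathcomp Require Import all_classical all_reals all_analysis.
Set Implicit Arguments.
Unset Strict Implicit.
Unset Printing Implicit Defensive.
Import Order.TTheory GRing.Theory Num.Theory.
Import numFieldNormedType.Exports.
Local Open Scope classical_set_scope.
Local Open Scope ring_scope.

(* Class C^k on an open set O.  In finite dimension, f is C^(k+1) iff it is
   Frechet differentiable on O and all its directional derivatives are C^k. *)
Fixpoint class_C {R : realType} {V W : normedModType R} (k : nat)
    (O : set V) (f : V -> W) : Prop :=
  if k is k'.+1 then
    (forall x, O x -> differentiable f x) /\
    (forall w : V, class_C k' O (fun x => 'D_w f x))
  else forall x, O x -> {for x, continuous f}.

(* Smoothness on an arbitrary subset A of a Euclidean space: f coincides near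
   each point of A with a C^oo map defined on an open set of the ambient space.
   Values of f outside A are irrelevant. *)
Definition smooth_on {R : realType} {n m : nat} (A : set 'rV[R]_n)
    (f : 'rV[R]_n -> 'rV[R]_m) : Prop :=
  forall x, A x -> exists (O : set 'rV[R]_n) (g : 'rV[R]_n -> 'rV[R]_m),
    [/\ open O, O x, forall k, class_C k O g & {in A `&` O, f =1 g}].

Definition diffeo {R : realType} {n m : nat} (A : set 'rV[R]_n)
    (B : set 'rV[R]_m) (f : 'rV[R]_n -> 'rV[R]_m) (g : 'rV[R]_m -> 'rV[R]_n) :=
  [/\ smooth_on A f, smooth_on B g, set_fun A B f, set_fun B A g &
      {in A, cancel f g} /\ {in B, cancel g f}].

Definition rel_open {T : topologicalType} (M W : set T) :=
  exists2 O, open O & W = M `&` O.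

Definition unit_cube {R : realType} (d : nat) : set 'rV[R]_d :=
  [set y | forall i, `|y ord0 i| < 1].

(* A chart of the d-dimensional submanifold M, with image a cube, in which each
   connected component of W `&` L, for every L in F, is given by the equations
   y_i = const for i >= k. *)
Definition foliated_chart {R : realType} {n : nat} (k d : nat)
    (M : set 'rV[R]_n) (F : set (set 'rV[R]_n)) (W : set 'rV[R]_n)
    (phi : 'rV[R]_n -> 'rV[R]_d) (psi : 'rV[R]_d -> 'rV[R]_n) : Prop :=
  [/\ rel_open M W, diffeo W (@unit_cube R d) phi psi &
      forall L, F L -> forall x, (W `&` L) x ->
        connected_component (W `&` L) x =
        [set y | W y /\ forall i : 'I_d, (k <= i)%N ->
                          phi y ord0 i = phi x ord0 i]].

(* The members of F are the leaves of a smooth foliation, with k-dimensional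
   leaves, of the d-dimensional submanifold M of R^n. *)
Definition smooth_foliation {R : realType} {n : nat} (k d : nat)
    (M : set 'rV[R]_n) (F : set (set 'rV[R]_n)) : Prop :=
  [/\ partition F id M, forall L, F L -> connected L &
      forall x, M x -> exists W phi psi,
        W x /\ foliated_chart (d := d) k M F W phi psi].

Definition dot {R : realType} {n : nat} (x y : 'rV[R]_n) : R :=
  \sum_(i < n) x ord0 i * y ord0 i.

Definition S4 {R : realType} : set 'rV[R]_5 := [set x | dot x x = 1].

Definition sdist {R : realType} (x y : 'rV[R]_5) : R := acos (dot x y).

Definition geodesic_sphere {R : realType} (c : 'rV[R]_5) (r : R) :
    set 'rV[R]_5 := [set x | S4 x /\ sdist x c = r].

Definition is_great_sphere {R : realType} (N : set 'rV[R]_5) : Prop :=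
  exists2 e : 'rV[R]_5, e != 0 & N = S4 `&` [set x | dot x e = 0].

(* The open zone between geodesic_sphere c r and its antipodal image, which is
   geodesic_sphere c (pi - r). *)
Definition exterior {R : realType} (c : 'rV[R]_5) (r : R) : set 'rV[R]_5 :=
  [set x | S4 x /\ Num.min r (pi - r) < sdist x c < Num.max r (pi - r)].

(* Tangent space at p of S4 and of the spheres centered at c: S4 is the level
   set of dot x x, and geodesic_sphere c r is cut out of it by dot x c. *)
Definition tangent_S4 {R : realType} (p : 'rV[R]_5) : set 'rV[R]_5 :=
  [set w | dot p w = 0].

Definition tangent_sphere {R : realType} (c p : 'rV[R]_5) : set 'rV[R]_5 :=
  tangent_S4 p `&` [set w | dot c w = 0].

Definition smooth_unit_field {R : realType} (c : 'rV[R]_5) (r : R)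
    (v : 'rV[R]_5 -> 'rV[R]_5) : Prop :=
  smooth_on (geodesic_sphere c r) v /\
  forall p, geodesic_sphere c r p ->
    tangent_sphere c p (v p) /\ dot (v p) (v p) = 1.

(* The geodesic of S4 with initial velocity u at p, for u a unit vector. *)
Definition geodesic {R : realType} (p u : 'rV[R]_5) (t : R) : 'rV[R]_5 :=
  cos t *: p + sin t *: u.

Definition rays {R : realType} (N : set 'rV[R]_5)
    (v : 'rV[R]_5 -> 'rV[R]_5) : set (set 'rV[R]_5) :=
  [set geodesic p (v p) @` `]0, pi[ | p in N].

Definition bifoliating {R : realType} (c : 'rV[R]_5) (r : R)
    (v : 'rV[R]_5 -> 'rV[R]_5) : Prop :=
  let N := geodesic_sphere c r in
  smooth_foliation 1 4 (exterior c r) (rays N v) /\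
  smooth_foliation 1 4 (exterior c r) (rays N (fun p => - v p)).

(* a x w is the value of the 1-form a on the tangent vector w at x. *)
Definition pullback {R : realType} {n m : nat} (f : 'rV[R]_n -> 'rV[R]_m)
    (a : 'rV[R]_m -> 'rV[R]_m -> R) (x u : 'rV[R]_n) : R :=
  a (f x) ('D_u f x).

(* da(u, w) = u(a(w)) - w(a(u)) for the constant fields u, w, whose bracket
   vanishes. *)
Definition ext_d {R : realType} {n : nat} (a : 'rV[R]_n -> 'rV[R]_n -> R)
    (x u w : 'rV[R]_n) : R :=
  'D_u (fun y => a y w) x - 'D_w (fun y => a y u) x.

Definition wedge12 {R : realType} {V : Type} (a : V -> R) (b : V -> V -> R)
    (u1 u2 u3 : V) : R :=
  a u1 * b u2 u3 + a u2 * b u3 u1 + a u3 * b u1 u2.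

(* The 1-form a on the 3-dimensional submanifold N of R^n is contact: in every
   local parametrization psi : O -> N (O open in R^3), the 3-form
   psi^*a /\ d(psi^*a) vanishes nowhere.  Only the values of a on tangent
   vectors to N are used. *)
Definition contact_form {R : realType} {n : nat} (N : set 'rV[R]_n)
    (a : 'rV[R]_n -> 'rV[R]_n -> R) : Prop :=
  forall (O : set 'rV[R]_3) (W : set 'rV[R]_n)
    (psi : 'rV[R]_3 -> 'rV[R]_n) (phi : 'rV[R]_n -> 'rV[R]_3),
    open O -> rel_open N W -> diffeo O W psi phi ->
    forall x, O x -> exists u1 u2 u3 : 'rV[R]_3,
      wedge12 (pullback psi a x) (ext_d (pullback psi a) x) u1 u2 u3 != 0.

(* Main.v *)
(** Suppose that alpha /\ d(alpha) vanishes at p = psi x, put V = v p, and let A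
    and B be the differentials of psi and of v o psi at x.  Since N is a round
    sphere, B maps the kernel of alpha into the plane orthogonal to p, c and V,
    which is the image of that kernel under A, and the vanishing of d(alpha) on
    the kernel says that this endomorphism of the plane is self-adjoint.  So it
    has a real eigenvector: B u = l A u with A u != 0.  The Jacobi field
    J(t) = cos t A u + sin t B u = (cos t + l sin t) A u of the corresponding
    variation of rays vanishes at some t0 in ]0, pi[.  In a foliated chart the
    transverse coordinates of the varied rays do not depend on t, hence neither
    do those of J: as J(t0) = 0, all J(t) for t near t0 are tangent to the leaf.
    They are also tangent to the parallel spheres of N, which the rays cross
    transversally because N is not a great sphere.  So J vanishes on an interval,
    which is absurd. *)

Require Import Defs.
From HB Require Import structures.
From mathcomp Require Import all_boot all_order all_algebra.
From mathcomp Require Import all_classical all_reals all_analysis.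
From mathcomp Require Import ring lra.
Import Order.TTheory GRing.Theory Num.Theory.
Import numFieldNormedType.Exports.
Local Open Scope classical_set_scope.
Local Open Scope ring_scope.

(** * Derivatives and Schwarz's theorem *)

(** Both sides are limits of the same difference quotient. In one variable derivability is
    differentiability, so this gives access to the chain rule for differentials. *)
Lemma is_derive1P {R : realType} {V W : normedModType R} (f : V -> W)
    (x u : V) (d : W) :
  is_derive x u f d <-> is_derive (0 : R) 1 (fun t : R => f (t *: u + x)) d.
Proof.
have E : 'D_1 (fun t : R => f (t *: u + x)) 0 = 'D_u f x.
  rewrite /derive; set g1 := fun h => h^-1 *: _; set g2 := fun h => h^-1 *: _.
  suff -> : g1 = g2 by [].
  by rewrite funeqE /g1 /g2 => h /=; rewrite addr0 scale0r add0r [_%:A]mulr1.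
have D := derivable1P f x u.
by split=> -[/D df <-]; apply: DeriveDef.
Qed.

(** The inner map needs only a derivative along u: restricted to the line through x in that
    direction, it becomes differentiable. *)
Lemma is_derive_comp {R : realType} {U V W : normedModType R} (g : U -> V)
    (f : V -> W) (x u : U) (d : V) :
  differentiable f (g x) -> is_derive x u g d ->
  is_derive x u (f \o g) ('D_d f (g x)).
Proof.
move=> df /is_derive1P[]; set h := fun t => _ => dh <-; apply/is_derive1P.
have h0 : h 0 = g x by rewrite /h scale0r add0r.
have {}dh : differentiable h 0 by apply/derivable1_diffP.
have dfh : differentiable f (h 0) by rewrite h0.
have dc : differentiable (f \o h) 0 by exact: differentiable_comp.
apply: DeriveDef; first exact: diff_derivable.
rewrite -h0 (deriveE _ dh) (deriveE _ dfh) (deriveE (f := f \o h) _ dc).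
by rewrite (diff_comp dh dfh).
Qed.

Lemma is_derive_scalel {R : realType} {U V : normedModType R} (f : U -> R)
    (a : V) (x u : U) (d : R) :
  is_derive x u f d -> is_derive x u (fun y => f y *: a) (d *: a).
Proof.
move=> df; pose g (s : R) := s *: a.
have dg : is_diff (f x) g g by exact: is_diff_scalel.
apply: is_derive_eq (is_derive_comp f g x u d _ df) _ => //.
by rewrite deriveE // diff_val.
Qed.

Lemma is_derive_line {R : realType} {V : normedModType R} (x u : V) (s : R) :
  is_derive s 1 (fun t : R => x + t *: u) u.
Proof.
have := is_deriveD (is_derive_cst x s 1) (is_derive_scalel _ u _ _ _ (is_derive_id s 1)).
by rewrite add0r scale1r.
Qed.

Lemma deriveZ_dir {R : realType} {V W : normedModType R} (f : V -> W)
    (x u : V) (a : R) : differentiable f x -> 'D_(a *: u) f x = a *: 'D_u f x.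
Proof. by move=> df; rewrite !deriveE // linearZ. Qed.

Lemma is_derive_coord {R : realType} {V : normedModType R} {m n : nat}
    (f : V -> 'M[R]_(m, n)) (x u : V) (d : 'M[R]_(m, n)) i j :
  is_derive x u f d -> is_derive x u (fun y => f y i j) (d i j).
Proof.
move=> [df <-]; apply: DeriveDef; first exact: ((derivable_mxP f x u).1 df i j).
by rewrite (derive_mx df) mxE.
Qed.

Lemma is_derive_dot {R : realType} {V : normedModType R} {n : nat}
    (f g : V -> 'rV[R]_n) (x u : V) (df dg : 'rV[R]_n) :
  is_derive x u f df -> is_derive x u g dg ->
  is_derive x u (fun y => dot (f y) (g y)) (dot (f x) dg + dot df (g x)).
Proof.
move=> Hf Hg.
have H i : is_derive x u (fun y => f y ord0 i * g y ord0 i)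
    (f x ord0 i * dg ord0 i + df ord0 i * g x ord0 i).
  apply: is_derive_eq.
    by apply: is_deriveM; exact: is_derive_coord.
  by congr (_ + _); rewrite [LHS]mulrC.
have := is_derive_sum H; rewrite big_split.
by congr is_derive; apply/funext => y; rewrite fct_sumE.
Qed.

(** The mean value theorem is applied twice: to [phi], then in the direction w to [fu]. *)
Lemma second_difference {R : realType} {V : normedModType R}
    (f fu fuw : V -> R) (x u w : V) (h : R) : 0 < h ->
  (forall a b, 0 <= a <= h -> 0 <= b <= h ->
     is_derive (x + a *: u + b *: w) u f (fu (x + a *: u + b *: w)) /\
     is_derive (x + a *: u + b *: w) w fu (fuw (x + a *: u + b *: w))) ->
  exists a b, [/\ 0 <= a <= h, 0 <= b <= h &
    f (x + h *: u + h *: w) - f (x + h *: u) - (f (x + h *: w) - f x) =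
    h ^+ 2 * fuw (x + a *: u + b *: w)].
Proof.
move=> h0 H.
pose phi a := f (x + a *: u + h *: w) - f (x + a *: u).
have line (g g' : V -> R) (y d : V) (s : R) :
    is_derive (y + s *: d) d g (g' (y + s *: d)) ->
    is_derive s 1 (fun t : R => g (y + t *: d)) (g' (y + s *: d)).
  move=> /is_derive1P dg; apply/is_derive1P.
  under eq_fun do rewrite [_%:A]mulr1 scalerDl addrCA.
  by [].
have dphi a : 0 <= a <= h -> is_derive a 1 phi
    (fu (x + a *: u + h *: w) - fu (x + a *: u)).
  move=> ah; apply: is_deriveB.
    under eq_fun do rewrite addrAC.
    rewrite addrAC; apply: line; rewrite addrAC.
    by apply: (H _ _ _ _).1 => //; rewrite lexx ltW.
  apply: line; have := (H a 0 ah _).1; rewrite scale0r addr0; apply.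
  by rewrite lexx ltW.
have [a ah Ea] : exists2 a, a \in `[0, h] &
    phi h - phi 0 = (fu (x + a *: u + h *: w) - fu (x + a *: u)) * (h - 0).
  apply: (MVT_segment (f := phi)
    (df := fun a => fu (x + a *: u + h *: w) - fu (x + a *: u)) (ltW h0)).
    by move=> s; rewrite in_itv /= => /andP[s0 sh]; apply: dphi; rewrite !ltW.
  apply: derivable_within_continuous => s; rewrite in_itv /= => sh.
  by have [] := dphi s sh.
rewrite in_itv /= in ah.
have dchi t : 0 <= t <= h -> is_derive t 1 (fun t => fu (x + a *: u + t *: w))
    (fuw (x + a *: u + t *: w)).
  by move=> th; apply: line; exact: (H _ _ _ _).2.
have [b bh Eb] : exists2 b, b \in `[0, h] &
    fu (x + a *: u + h *: w) - fu (x + a *: u + 0 *: w) =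
    fuw (x + a *: u + b *: w) * (h - 0).
  apply: (MVT_segment (f := fun t => fu (x + a *: u + t *: w))
    (df := fun t => fuw (x + a *: u + t *: w)) (ltW h0)).
    by move=> s; rewrite in_itv /= => /andP[s0 sh]; apply: dchi; rewrite !ltW.
  apply: derivable_within_continuous => s; rewrite in_itv /= => sh.
  by have [] := dchi s sh.
rewrite in_itv /= in bh.
exists a, b; split => //; move: Ea Eb; rewrite /phi !scale0r !addr0 => -> ->.
by rewrite subr0 expr2; ring.
Qed.

(** The second difference over a square is unchanged when u and w are exchanged, so [fuw] and [fwu]
    agree at two points of every small square; continuity at x carries this to x. *)
Lemma mixed_derivatives_eq {R : realType} {V : normedModType R} (O : set V)
    (f fu fw fuw fwu : V -> R) (x u w : V) : open O -> O x ->
  (forall y, O y -> is_derive y u f (fu y) /\ is_derive y w fu (fuw y)) ->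
  (forall y, O y -> is_derive y w f (fw y) /\ is_derive y u fw (fwu y)) ->
  {for x, continuous fuw} -> {for x, continuous fwu} ->
  fuw x = fwu x.
Proof.
move=> oO Ox Hu Hw cu cw.
have small (A : set V) : nbhs x A -> exists2 h : R, 0 < h &
    forall a b, 0 <= a <= h -> 0 <= b <= h -> A (x + a *: u + b *: w).
  move=> /nbhs_normP[e /= e0 eA].
  pose k := `|u| + `|w| + 1.
  have k0 : 0 < k by rewrite ltr_wpDl // addr_ge0.
  (* The summand 1 in [k] allows u = w = 0. On a square of side [e / k / 2] the displacement has
     norm at most half of e. *)
  exists (e / k / 2); first by rewrite !divr_gt0.
  move=> a b /andP[a0 ah] /andP[b0 bh]; apply: eA => /=.
  rewrite -addrA opprD addNKr normrN.
  apply: le_lt_trans (ler_normD _ _) _; rewrite !normrZ !ger0_norm //.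
  apply: (@le_lt_trans _ _ (e / k / 2 * k)).
    rewrite (@le_trans _ _ (e / k / 2 * (`|u| + `|w|))) //.
      by rewrite mulrDr lerD // ler_wpM2r.
    by rewrite ler_wpM2l ?lerDl // !divr_ge0 // ltW.
  by rewrite mulrAC divfK ?gt_eqF // ltr_pdivrMr // ltr_pMr // ltr1n.
apply: contrapT => /eqP ne.
have [e e0 He] : exists2 e : R, 0 < e & forall y z, `|fuw x - y| < e ->
    `|fwu x - z| < e -> y != z.
  (* Balls of radius half the distance between the two values are disjoint. *)
  exists (`|fuw x - fwu x| / 2); first by rewrite divr_gt0 // normr_gt0 subr_eq0.
  move=> y z yx zx; apply/eqP => yz; move: yx zx; rewrite yz => yx zx.
  have := ler_distD z (fuw x) (fwu x); rewrite (distrC z).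
  by rewrite leNgt (splitr `|fuw x - fwu x|) ltrD.
move/cvgrPdist_lt : cu => /(_ _ e0) cu; move/cvgrPdist_lt : cw => /(_ _ e0) cw.
have [h h0 Hh] := small _ (filterI (open_nbhs_nbhs (conj oO Ox))
  (filterI cu cw)).
have [a [b [ah bh E]]] := second_difference f fu fuw x u w h h0
  (fun a b ah bh => Hu _ (Hh a b ah bh).1).
(* Here u and w have exchanged roles: [a'] is the parameter along w and [b'] the one along u. *)
have [|a' [b' [ah' bh' E']]] := @second_difference _ _ f fw fwu x w u h h0.
  by move=> s t sh th; rewrite addrAC; exact: (Hw _ (Hh t s th sh).1).
have := He _ _ (Hh a b ah bh).2.1 (Hh b' a' bh' ah').2.2.
suff -> : fuw (x + a *: u + b *: w) = fwu (x + b' *: u + a' *: w) by rewrite eqxx.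
have h20 : h ^+ 2 != 0 by rewrite expf_eq0 gt_eqF.
apply: (mulfI h20); rewrite -E (addrAC x (b' *: u)) -E'.
rewrite (addrAC x (h *: w)); ring.
Qed.

(** * Linear algebra *)

Lemma dotE {R : realType} {n : nat} (x y : 'rV[R]_n) :
  dot x y = (x *m y^T) ord0 ord0.
Proof. by rewrite mxE; apply: eq_bigr => i _; rewrite mxE. Qed.

Lemma dotC {R : realType} {n : nat} (x y : 'rV[R]_n) : dot x y = dot y x.
Proof. by apply: eq_bigr => i _; rewrite mulrC. Qed.

Lemma dotDl {R : realType} {n : nat} (x y z : 'rV[R]_n) :
  dot (x + y) z = dot x z + dot y z.
Proof. by rewrite !dotE mulmxDl mxE. Qed.

Lemma dotZl {R : realType} {n : nat} (a : R) (x y : 'rV[R]_n) :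
  dot (a *: x) y = a * dot x y.
Proof. by rewrite !dotE -scalemxAl mxE. Qed.

Lemma dotDr {R : realType} {n : nat} (x y z : 'rV[R]_n) :
  dot x (y + z) = dot x y + dot x z.
Proof. by rewrite ![dot x _]dotC dotDl. Qed.

Lemma dotZr {R : realType} {n : nat} (a : R) (x y : 'rV[R]_n) :
  dot x (a *: y) = a * dot x y.
Proof. by rewrite ![dot x _]dotC dotZl. Qed.

Lemma dot0 {R : realType} {n : nat} (x : 'rV[R]_n) : dot x 0 = 0.
Proof. by rewrite dotE trmx0 mulmx0 mxE. Qed.

Lemma dot_gt0 {R : realType} {n : nat} (x : 'rV[R]_n) : x != 0 -> 0 < dot x x.
Proof.
move=> x0; have nn i : true -> 0 <= x ord0 i * x ord0 i.
  by rewrite -expr2 sqr_ge0.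
rewrite lt_def sumr_ge0 // andbT; apply: contra x0 => /eqP/psumr_eq0P H.
apply/eqP/rowP => i; rewrite mxE.
by have /eqP := H nn i isT; rewrite mulf_eq0 orbb => /eqP.
Qed.

(* The hypotheses say that [[a, b], [c, d]] is self-adjoint for the positive
   definite form [[g, h], [h, k]]. *)
Lemma discriminant_selfadjoint {R : realType} (a b c d g h k : R) :
  0 < g -> 0 < k -> 0 < g * k - h ^+ 2 -> a * h + b * k = c * g + d * h ->
  0 <= (a - d) ^+ 2 + 4 * (b * c).
Proof.
move=> g0 k0 gk E; rewrite leNgt; apply/negP => D1.
have bc : b * c < 0 by have := sqr_ge0 (a - d); lra.
(* Self-adjointness reads b k - c g = (d - a) h. With D the discriminant, (b k + c g)^2 then equals
   D h^2 + 4 b c (g k - h^2), which would be negative if D were. *)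
have E2 : (b * k - c * g) ^+ 2 = (a - d) ^+ 2 * h ^+ 2.
  rewrite -exprMn -[RHS]sqrrN; congr (_ ^+ 2); lra.
have : 0 <= (b * k + c * g) ^+ 2 by exact: sqr_ge0.
have -> : (b * k + c * g) ^+ 2 = (b * k - c * g) ^+ 2 + 4 * (b * c) * (g * k).
  by ring.
rewrite E2 => F.
have h2 : 0 <= h ^+ 2 by exact: sqr_ge0.
have : 0 < (- (b * c)) * (g * k - h ^+ 2) by rewrite mulr_gt0 // oppr_gt0.
have : ((a - d) ^+ 2 + 4 * (b * c)) * h ^+ 2 <= 0 by rewrite mulr_le0_ge0 // ltW.
lra.
Qed.

(** The spectral theorem in dimension 2, relative to a basis with Gram matrix [G]: symmetry of
    [S *m G] expresses self-adjointness and makes the discriminant of the characteristic polynomial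
    nonnegative. *)
Lemma eigenvalue2_selfadjoint {R : realType} (S G : 'M[R]_2) :
  0 < G ord0 ord0 -> 0 < G ord_max ord_max ->
  0 < G ord0 ord0 * G ord_max ord_max - G ord0 ord_max ^+ 2 ->
  G ord_max ord0 = G ord0 ord_max ->
  (S *m G) ord0 ord_max = (S *m G) ord_max ord0 ->
  exists l (x : 'rV[R]_2), x != 0 /\ x *m S = l *: x.
Proof.
rewrite !mxE !big_ord_recr !big_ord0 /= !add0r.
have -> : widen_ord (leqnSn 1) ord_max = ord0 by apply/val_inj.
set a := S _ _; set b := S _ _; set c := S ord_max ord0; set d := S _ _.
set g := G ord0 ord0; set k := G ord_max ord_max; set h := G ord0 ord_max.
move=> g0 k0 gk -> E.
have D0 := discriminant_selfadjoint _ _ _ _ _ _ _ g0 k0 gk E.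
pose s := Num.sqrt ((a - d) ^+ 2 + 4 * (b * c)).
have s2 : s ^+ 2 = (a - d) ^+ 2 + 4 * (b * c) by exact: sqr_sqrtr.
(* The larger root of the characteristic polynomial. *)
pose l := (a + d + s) / 2.
have : \det (S - l%:M) == 0.
  rewrite (expand_det_row _ ord0) !big_ord_recr big_ord0 /= add0r.
  have -> : widen_ord (leqnSn 1) ord_max = ord0 by apply/val_inj.
  rewrite /cofactor !det_mx11 !mxE /=.
  have -> : lift (ord0 : 'I_2) ord0 = ord_max by apply/val_inj.
  have -> : lift (ord_max : 'I_2) ord0 = ord0 by apply/val_inj.
  rewrite -/a -/b -/c -/d /= !mulr1n !mulr0n /bump /= addn0 addn1 expr0 expr1.
  apply/eqP.
  have -> : (a - l) * (1 * (d - l)) + (b - 0) * (-1 * (c - 0)) =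
    (s ^+ 2 - ((a - d) ^+ 2 + 4 * (b * c))) / 4 by rewrite /l; field.
  by rewrite s2 subrr mul0r.
move=> /det0P[x x0 /eqP]; rewrite mulmxBr subr_eq0 => /eqP xS.
by exists l, x; split=> //; rewrite xS mul_mx_scalar.
Qed.

(** [A] and [B] stand for the differentials, acting on rows, of a parametrization g of the sphere
    with value p and of the field along it, with value [V]. The conditions on them come from
    differentiating the relations between g, c and the field. *)
Lemma eigenvector_of_degenerate_form {R : realType} (A B : 'M[R]_(3, 5))
    (p c V : 'rV[R]_5) :
  row_free A -> row_free (col_mx p c) ->
  dot p V = 0 -> dot c V = 0 -> dot V V = 1 ->
  (forall u, dot p (u *m A) = 0) -> (forall u, dot c (u *m A) = 0) ->
  (forall u, dot V (u *m B) = 0) -> (forall u, dot c (u *m B) = 0) ->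
  (forall u, dot p (u *m B) = - dot V (u *m A)) ->
  (forall u1 u2 u3, wedge12 (fun u => dot V (u *m A))
     (fun u w => dot (u *m B) (w *m A) - dot (w *m B) (u *m A)) u1 u2 u3 = 0) ->
  exists l (u : 'rV[R]_3), u != 0 /\ u *m B = l *: (u *m A).
Proof.
move=> fA fP pV cV VV pA cA VB cB pB wedge0.
set P := col_mx p c in fP.
have perp (M : nat) (X : 'M[R]_(M, 5)) :
    (forall i, dot p (row i X) = 0) -> (forall i, dot c (row i X) = 0) ->
    (X <= kermx P^T)%MS.
  move=> pX cX; apply/sub_kermxP; rewrite tr_col_mx mul_mx_row.
  suff H (y : 'rV[R]_5) : (forall i, dot y (row i X) = 0) -> X *m y^T = 0.
    by rewrite !H // row_mx0.
  move=> yX; apply/matrixP => i j; rewrite !mxE -[RHS](yX i).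
  by apply: eq_bigr => k _; rewrite !mxE mulrC ord1.
(* The three independent rows of [A] lie in the orthogonal complement of p and c, whose dimension is
   5 - 2. *)
have spanA : (kermx P^T <= A)%MS.
  have sub : (A <= kermx P^T)%MS.
    by apply: perp => i; rewrite rowE ?pA ?cA.
  rewrite -(mxrank_leqif_sup sub) mxrank_ker mxrank_tr.
  by rewrite (eqP fP) (eqP fA).
have [u1 u1A] : exists u1, V = u1 *m A.
  apply/submxP; apply: submx_trans spanA; apply: perp => i;
  by rewrite row_id.
(* The column of values of the 1-form on the basis; it is nonzero because the form takes the value 1
   at [u1]. *)
pose al := A *m V^T.
have rk1 : \rank al = 1%N.
  apply/eqP; rewrite eqn_leq rank_leq_col lt0n mxrank_eq0.
  apply/eqP => al0; have := VV; rewrite dotE {1}u1A -mulmxA -/al al0 mulmx0 mxE.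
  by move/eqP; rewrite eq_sym oner_eq0.
have [K fK eK] : exists2 K : 'M[R]_(2, 3), row_free K & (K == kermx al)%MS.
  (* The number of rows is first kept as a rank, the size of [row_base], and only then rewritten to
     3 - 1. *)
  have : exists2 K : 'M[R]_(\rank (kermx al), 3), row_free K
      & (K == kermx al)%MS.
    exists (row_base (kermx al)); first exact: row_base_free.
    exact/eqmxP/eq_row_base.
  by rewrite mxrank_ker rk1.
have Kal : K *m al = 0 by apply/sub_kermxP; case/andP: eK.
have rowK i : dot V (row i K *m A) = 0.
  by rewrite dotC dotE -mulmxA -/al -row_mul Kal mxE mxE.
have [T KB] : exists T, K *m B = T *m A.
  apply/submxP; apply: submx_trans spanA; apply: perp => i.
    by rewrite row_mul pB rowK oppr0.
  by rewrite row_mul cB.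
(* Since the image of [B] is orthogonal to [V], the endomorphism [T] preserves the kernel of the
   1-form; [S] is its matrix in the basis [K]. *)
have [S TS] : exists S, T = S *m K.
  apply/submxP; suff TK : (T <= kermx al)%MS.
    by apply: submx_trans TK _; case/andP: eK.
  apply/sub_kermxP; rewrite mulmxA -KB; apply/matrixP => i j.
  have := VB (row i K); rewrite dotC dotE -!row_mul mxE => H.
  by rewrite (ord1 j) [RHS]mxE -[RHS]H.
pose KA := K *m A.
have fKA : row_free KA by rewrite /row_free mxrankMfree.
pose k0 := row ord0 KA; pose k1 := row ord_max KA.
pose G := KA *m KA^T.
have GE i j : G i j = dot (row i KA) (row j KA).
  by rewrite mxE; apply: eq_bigr => k _; rewrite !mxE.
have indep (x : 'rV[R]_2) : x *m KA = 0 -> x = 0.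
  by move=> H; apply: (row_free_inj fKA); rewrite H mul0mx.
have combo (s t : R) : s *: k0 + t *: k1 = 0 -> s = 0 /\ t = 0.
  move=> st; pose x : 'rV[R]_2 := \row_i (if i == ord0 then s else t).
  have /indep/rowP x0 : x *m KA = 0.
    rewrite mulmx_sum_row !big_ord_recr big_ord0 /= add0r -st !mxE /=.
    by congr (_ *: row _ _ + _); apply/val_inj.
  by have := x0 ord0; have := x0 ord_max; rewrite !mxE.
have k00 : 0 < dot k0 k0.
  apply: dot_gt0; apply/eqP => H.
  have [|/eqP] := combo 1 0; last by rewrite oner_eq0.
  by rewrite scale1r scale0r addr0.
have k10 : 0 < dot k1 k1.
  apply: dot_gt0; apply/eqP => H.
  have [|_ /eqP] := combo 0 1; last by rewrite oner_eq0.
  by rewrite scale1r scale0r add0r.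
(* Strict Cauchy-Schwarz: the vector below is nonzero, and its squared norm is the Gram determinant
   times [dot k1 k1]. *)
have gram : 0 < dot k0 k0 * dot k1 k1 - dot k0 k1 ^+ 2.
  have : 0 < dot (dot k1 k1 *: k0 + - dot k0 k1 *: k1)
               (dot k1 k1 *: k0 + - dot k0 k1 *: k1).
    apply: dot_gt0; apply/eqP => /combo[/eqP + _].
    by rewrite gt_eqF.
  rewrite !(dotDl, dotDr, dotZl, dotZr) (dotC k1 k0) => H.
  by rewrite -(pmulr_rgt0 _ k10); apply: etrans H; congr (0 < _); ring.
(* On [u1] and the two rows of [K], the 3-form reduces to the 2-form on these rows, as the 1-form is
   1 on [u1] and 0 on the kernel. *)
have sym : (S *m G) ord0 ord_max = (S *m G) ord_max ord0.
  have SG i j : (S *m G) i j = dot (row i K *m B) (row j K *m A).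
    rewrite -row_mul KB TS -mulmxA -/KA /G mulmxA -row_mul.
    by rewrite mxE; apply: eq_bigr => k _; rewrite !mxE.
  rewrite !SG; have := wedge0 u1 (row ord0 K) (row ord_max K).
  rewrite /wedge12 !rowK -u1A VV mul1r !mul0r !addr0 => /eqP.
  by rewrite subr_eq0 => /eqP.
have [l [x [x0 xS]]] : exists l (x : 'rV[R]_2), x != 0 /\ x *m S = l *: x.
  by apply: (eigenvalue2_selfadjoint S G) => //; rewrite ?GE // dotC.
exists l, (x *m K); split.
  by apply: contra x0 => /eqP xK; apply/eqP/indep; rewrite /KA mulmxA xK mul0mx.
by rewrite -!mulmxA KB TS -mulmxA mulmxA xS scalemxAl.
Qed.

(** * Differentiated relations, and geodesic spheres as level sets *)

Lemma derive_dot_near_const {R : realType} {V : normedModType R} {n : nat}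
    (f g : V -> 'rV[R]_n) (x u : V) (df dg : 'rV[R]_n) (k : R) :
  is_derive x u f df -> is_derive x u g dg ->
  (\forall y \near x, dot (f y) (g y) = k) -> dot (f x) dg + dot df (g x) = 0.
Proof.
move=> Hf Hg fgk; have [_ <-] := is_derive_dot _ _ _ _ _ _ Hf Hg.
by rewrite -[RHS](derive_cst k x u); exact: near_eq_derive.
Qed.

Lemma mixed_derivatives_rV {R : realType} {n m : nat} (U : set 'rV[R]_n)
    (g : 'rV[R]_n -> 'rV[R]_m) (x u w : 'rV[R]_n) :
  open U -> U x -> class_C 2 U g ->
  'D_u (fun y => 'D_w g y) x = 'D_w (fun y => 'D_u g y) x.
Proof.
move=> oU Ux [dg Dg]; apply/rowP => j.
have d1 a y : U y -> is_derive y a g ('D_a g y).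
  by move=> Uy; apply: derivableP; apply: diff_derivable; exact: dg.
have d2 a b y : U y ->
    is_derive y b (fun z => 'D_a g z) ('D_b (fun z => 'D_a g z) y).
  by move=> Uy; apply: derivableP; apply: diff_derivable; exact: (Dg a).1.
have cont a b : {for x, continuous (fun y => 'D_b (fun z => 'D_a g z) y ord0 j)}.
  have := (Dg a).2 b x Ux; move=> C.
  exact: (cvg_comp _ (fun M : 'rV[R]_m => M ord0 j) C (@coord_continuous _ _ _ _ _ _)).
apply: (mixed_derivatives_eq U (fun y => g y ord0 j)
  (fun y => 'D_w g y ord0 j) (fun y => 'D_u g y ord0 j)
  (fun y => 'D_u (fun z => 'D_w g z) y ord0 j)
  (fun y => 'D_w (fun z => 'D_u g z) y ord0 j) x w u oU Ux) => // y Uy.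
  by split; apply: is_derive_coord; [exact: d1|exact: d2].
by split; apply: is_derive_coord; [exact: d1|exact: d2].
Qed.

(** The squared norms of x + y and x - y are nonnegative. The bound puts the product in the range
    where [cos] inverts [acos]. *)
Lemma dot_unit_bound {R : realType} {n : nat} (x y : 'rV[R]_n) :
  dot x x = 1 -> dot y y = 1 -> -1 <= dot x y <= 1.
Proof.
move=> x1 y1.
have pos (a : R) : 0 <= dot (x + a *: y) (x + a *: y).
  by apply: sumr_ge0 => i _; rewrite -expr2 sqr_ge0.
have := pos 1; have := pos (-1).
rewrite !(dotDl, dotDr, dotZl, dotZr) x1 y1 (dotC y x).
by move=> ? ?; apply/andP; split; lra.
Qed.

Lemma geodesic_sphere_dot {R : realType} (c x : 'rV[R]_5) (r : R) :
  S4 c -> geodesic_sphere c r x -> dot c x = cos r.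
Proof.
move=> c1 [x1 <-]; rewrite /sdist acosK 1?dotC // in_itv /=.
exact: dot_unit_bound.
Qed.

Lemma geodesic_sphere_pi2_great {R : realType} (c : 'rV[R]_5) (r : R) :
  S4 c -> 0 < r < pi -> cos r = 0 -> is_great_sphere (geodesic_sphere c r).
Proof.
move=> c1 /andP[r0 rpi] cr0; exists c.
  apply/eqP => c0; have := c1; rewrite /S4 /= c0 dot0 => /eqP.
  by rewrite eq_sym oner_eq0.
apply/seteqP; split=> x /=.
  by move=> Nx; split; [exact: Nx.1|rewrite dotC (geodesic_sphere_dot c x r) // cr0].
move=> [x1 xc]; split=> //; rewrite /sdist xc -cr0 cosK // in_itv /=.
by rewrite !ltW.
Qed.

(** * Charts of the foliation and Jacobi fields *)

(** A and B need not be open, so f and g cannot be differentiated directly. Their smooth local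
    extensions can, but these are mutually inverse only along A. *)
Lemma diffeo_local_extension {R : realType} {n m : nat} (A : set 'rV[R]_n)
    (B : set 'rV[R]_m) (f : 'rV[R]_n -> 'rV[R]_m) (g : 'rV[R]_m -> 'rV[R]_n)
    (x : 'rV[R]_n) : diffeo A B f g -> A x ->
  exists F G, \forall y \near x, A y ->
    [/\ f y = F y, G (F y) = y, differentiable F y & differentiable G (F y)].
Proof.
move=> [sf sg fAB _ [fK _]] Ax.
have [U [F [oU Ux sF fF]]] := sf x Ax.
have [P [G [oP Pfx sG gG]]] := sg (f x) (fAB x Ax).
have fE y : A y -> U y -> f y = F y by move=> Ay Uy; apply: fF; rewrite inE.
have cF : {for x, continuous F} by apply/differentiable_continuous/((sF 1).1 x Ux).
have H : \forall y \near x, P (F y).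
  by apply: cF; apply: open_nbhs_nbhs; split=> //; rewrite -fE.
exists F, G; near=> y => Ay.
have Uy : U y by near: y; exact: open_nbhs_nbhs.
have Py : P (F y) by near: y.
have E := fE y Ay Uy.
split=> //; last 2 first.
- exact: (sF 1).1.
- exact: (sG 1).1.
rewrite -gG; first by rewrite -E fK // inE.
by rewrite inE; split=> //; rewrite -E; exact: fAB.
Unshelve. all: by end_near. Qed.

(** The chain rule along y: the differential of F loses no information on velocities of maps y along
    which G inverts F. *)
Lemma derive_left_inverse {R : realType} {U V W : normedModType R}
    (F : V -> W) (G : W -> V) (y : U -> V) (x u : U) (d : V) :
  differentiable F (y x) -> differentiable G (F (y x)) ->
  (\forall z \near x, y z = G (F (y z))) -> is_derive x u y d ->
  'D_('D_d F (y x)) G (F (y x)) = d.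
Proof.
move=> dF dG GF dy.
have dFy := is_derive_comp y F x u d dF dy.
have [_ D] := is_derive_comp (F \o y) G x u _ dG dFy.
by have [_ E] := near_eq_is_derive GF dy; apply: etrans (esym D) E.
Qed.

Lemma is_derive_geodesic {R : realType} (p u : 'rV[R]_5) (t : R) :
  is_derive t 1 (geodesic p u) (- sin t *: p + cos t *: u).
Proof. by apply: is_deriveD; exact: is_derive_scalel. Qed.

(** The focal time: t = [atan l + pi / 2] solves cot t = - l. *)
Lemma cot_angle {R : realType} (l : R) : exists2 t : R, 0 < t < pi &
  cos t + l * sin t = 0.
Proof.
have [lb ub tl] : [/\ - (pi / 2) < atan l, atan l < pi / 2 & tan (atan l) = l].
  by split; rewrite ?atan_gtNpi2 ?atan_ltpi2 ?atanK.
exists (atan l + pi / 2); first by apply/andP; split; lra.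
have c0 : cos (atan l) != 0 by rewrite gt_eqF // cos_gt0_pihalf // lb.
rewrite cosD sinD cos_pihalf sin_pihalf !mulr0 !mulr1 !add0r -{2}tl.
by rewrite /tan mulfVK // addNr.
Qed.

Lemma near_box {R : realType} {n : nat} (f g : R -> 'rV[R]_n) (t0 : R)
    (Q : set 'rV[R]_n) :
  {for 0, continuous f} -> {for 0, continuous g} ->
  nbhs (cos t0 *: f 0 + sin t0 *: g 0) Q ->
  exists2 e : R, 0 < e & forall s t, `|s| < e -> `|t - t0| < e ->
    Q (cos t *: f s + sin t *: g s).
Proof.
move=> cf cg nQ.
have : (fun z : R * R => cos z.2 *: f z.1 + sin z.2 *: g z.1) @ ((0 : R), t0) -->
    cos t0 *: f 0 + sin t0 *: g 0.
  have c1 : (fun z : R * R => z.1) @ ((0 : R), t0) --> (0 : R) by exact: cvg_fst.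
  have c2 : (fun z : R * R => z.2) @ ((0 : R), t0) --> t0 by exact: cvg_snd.
  apply: cvgD; apply: cvgZ.
  - exact: (cvg_comp (fun z : R * R => z.2) cos c2 (@continuous_cos R t0)).
  - exact: (cvg_comp (fun z : R * R => z.1) f c1 cf).
  - exact: (cvg_comp (fun z : R * R => z.2) sin c2 (@continuous_sin R t0)).
  - exact: (cvg_comp (fun z : R * R => z.1) g c1 cg).
move=> /(_ Q nQ)/nbhs_ballP[e /= e0 eQ]; exists e => // s t se te.
apply: (eQ (s, t)); split => /=; rewrite /ball /= ?sub0r ?normrN //.
by rewrite distrC.
Qed.

Lemma rV_delta0 {R : realType} {m : nat} (d : 'rV[R]_m.+1) :
  (forall i : 'I_m.+1, (1 <= i)%N -> d ord0 i = 0) ->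
  d = d ord0 ord0 *: delta_mx ord0 ord0.
Proof.
move=> d0; apply/rowP => i; rewrite !mxE /=.
by have [->|i0] := eqVneq i ord0; rewrite ?mulr1 // mulr0 d0 // lt0n.
Qed.

(** Along [sigma] the field varies to first order by l times the velocity w, so the variation field
    of the rays is a scalar function of t times w, with a zero in ]0, pi[. *)
Lemma rays_no_focal_point {R : realType} (c : 'rV[R]_5) (r : R)
    (v : 'rV[R]_5 -> 'rV[R]_5) (sigma : R -> 'rV[R]_5) (w : 'rV[R]_5) (l : R) :
  smooth_foliation 1 4 (exterior c r) (rays (geodesic_sphere c r) v) ->
  cos r != 0 ->
  (forall p, geodesic_sphere c r p -> dot c p = cos r /\ dot c (v p) = 0) ->
  (\forall s \near 0, geodesic_sphere c r (sigma s)) ->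
  is_derive (0 : R) 1 sigma w -> is_derive (0 : R) 1 (v \o sigma) (l *: w) ->
  w = 0.
Proof.
move=> [[cov _ _] _ charts] cr0 NP Nsig dsig dvsig.
set N := geodesic_sphere c r in Nsig NP cov.
have [t0 /andP[t00 t0pi] focal] := cot_angle l.
pose F s t := geodesic (sigma s) (v (sigma s)) t.
have exF s t : N (sigma s) -> 0 < t < pi -> exterior c r (F s t).
  move=> Ns tpi; rewrite -cov; exists (geodesic (sigma s) (v (sigma s)) @` `]0, pi[).
    by exists (sigma s).
  by exists t => //=; rewrite in_itv.
have N0 : N (sigma 0) by exact: nbhs_singleton Nsig.
have ex0 : exterior c r (F 0 t0) by apply: exF => //; rewrite t00.
have [W [phi [psi [Wx0 [[U oU WE] dif chart]]]]] := charts _ ex0.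
have [_ _ phiW _ _] := dif.
have [Phi [Psi ext]] := diffeo_local_extension _ _ _ _ _ dif Wx0.
have Ux0 : U (F 0 t0) by move: Wx0; rewrite WE => -[].
have csig : {for 0, continuous sigma}.
  by apply/differentiable_continuous/derivable1_diffP; case: dsig.
have cvsig : {for 0, continuous (v \o sigma)}.
  by apply/differentiable_continuous/derivable1_diffP; case: dvsig.
have [e1 e10 box1] := near_box sigma (v \o sigma) t0 _ csig cvsig
  (filterI (open_nbhs_nbhs (conj oU Ux0)) ext).
have [e2 /= e20 box2] := (nbhs_normP (0 : R) _).1 Nsig.
(* The bounds [e1] and [e2] keep the variation in the chart and [sigma] on the sphere; [t0] and
   [pi - t0] keep t in ]0, pi[. *)
pose e := Num.min (Num.min e1 e2) (Num.min t0 (pi - t0)).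
have e0 : 0 < e by rewrite !lt_min e10 e20 t00 subr_gt0.
have box s t : `|s| < e -> `|t - t0| < e -> [/\ N (sigma s), 0 < t < pi & W (F s t) /\
    [/\ phi (F s t) = Phi (F s t), Psi (Phi (F s t)) = F s t,
     differentiable Phi (F s t) & differentiable Psi (Phi (F s t))]].
  rewrite !lt_min => /andP[/andP[s1 s2] _] /andP[/andP[t1 _] /andP[ta tb]].
  have Ns : N (sigma s) by apply: box2; rewrite /= sub0r normrN.
  have tpi : 0 < t < pi.
    by move: ta tb; rewrite !ltr_norml => /andP[+ _] /andP[_ +]; lra.
  have [Us exts] := box1 s t s1 t1.
  have Ws : W (F s t) by rewrite WE; split=> //; exact: exF.
  by split=> //; split=> //; exact: exts.
(* The arc of the ray over ]t0 - e, t0 + e[ is connected and stays in the chart, hence lies in one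
   plaque. *)
have const s t (i : 'I_4) : `|s| < e -> `|t - t0| < e -> (1 <= i)%N ->
    Phi (F s t) ord0 i = Phi (F s t0) ord0 i.
  move=> se te i1; have t0e : `|t0 - t0| < e by rewrite subrr normr0.
  have [Ns tpi [Wt [<- _ _ _]]] := box s t se te.
  have [_ t0pi' [Wt0 [<- _ _ _]]] := box s t0 se t0e.
  pose L := geodesic (sigma s) (v (sigma s)) @` `]0, pi[.
  have FL : rays N v L by exists (sigma s).
  have LF t' : 0 < t' < pi -> L (F s t') by move=> ?; exists t' => //=; rewrite in_itv.
  have : connected_component (W `&` L) (F s t0) (F s t).
    exists (F s @` `]t0 - e, t0 + e[); last first.
      by exists t => //=; rewrite in_itv /=; move: te; rewrite ltr_distl.
    split.
    - by exists t0 => //=; rewrite in_itv /=; apply/andP; split; lra.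
    - move=> y [t' /= + <-]; rewrite in_itv /= -ltr_distl => te'.
      by have [_ tpi' [Wt' _]] := box s t' se te'; split=> //; exact: LF.
    - apply: connected_continuous_connected.
        by apply/connected_intervalP; exact: interval_is_interval.
      apply: derivable_within_continuous => t' _.
      by have [] := is_derive_geodesic (sigma s) (v (sigma s)) t'.
  by rewrite chart //; [case=> _ ->|split=> //; exact: LF].
(* [J] is the derivative of the variation in s at s = 0, and [T] the velocity of the central ray. *)
pose J t := (cos t + l * sin t) *: w.
pose T t := - sin t *: sigma 0 + cos t *: v (sigma 0).
have dJ t : is_derive (0 : R) 1 (F ^~ t) (J t).
  apply: is_derive_eq (is_deriveD (is_deriveZ (cos t) dsig)
    (is_deriveZ (sin t) dvsig)) _.
  by rewrite /J scalerDl scalerA mulrC.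
have dT (t : R) : is_derive t 1 (F 0) (T t) by exact: is_derive_geodesic.
have J0 : J t0 = 0 by rewrite /J focal scale0r.
have nT t : dot c (T t) = - (sin t * cos r).
  have [cs cv] := NP _ N0.
  by rewrite dotDr !dotZr cs cv mulr0 addr0 mulNr.
have nJ t : dot c (J t) = 0.
  rewrite dotZr; suff -> : dot c w = 0 by rewrite mulr0.
  have := derive_dot_near_const (cst c) sigma 0 1 _ _ (cos r)
    (is_derive_cst c (0 : R) 1) dsig.
  rewrite [dot 0 _]dotC dot0 addr0; apply.
  by near=> s; apply: (NP _ _).1; near: s.
have norm0 : `|0 : R| < e by rewrite normr0.
have nears : \forall s \near (0 : R), `|s| < e.
  by apply/nbhs_normP; exists e => // s /=; rewrite sub0r normrN.
have rigid t : `|t - t0| < e -> J t = 0.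
  move=> te.
  have [_ tpi [_ [_ _ dPhi dPsi]]] := box 0 t norm0 te.
  have neart : \forall t' \near t, `|t' - t0| < e.
    apply/nbhs_normP; exists (e - `|t - t0|) => /=; first by rewrite subr_gt0.
    move=> t' /=; rewrite ltrBrDr => tt'; apply: le_lt_trans tt'.
    by rewrite (distrC t t'); exact: ler_distD.
  have PJ := is_derive_comp (F ^~ t) Phi 0 1 _ dPhi (dJ t).
  have PT := is_derive_comp (F 0) Phi t 1 _ dPhi (dT t).
  have BJ : 'D_('D_(J t) Phi (F 0 t)) Psi (Phi (F 0 t)) = J t.
    apply: (derive_left_inverse Phi Psi (F ^~ t) 0 1) => //.
    near=> s; have se : `|s| < e by near: s.
    by have [_ _ [_ [_ -> _ _]]] := box s t se te.
  have BT : 'D_('D_(T t) Phi (F 0 t)) Psi (Phi (F 0 t)) = T t.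
    apply: (derive_left_inverse Phi Psi (F 0) t 1) => //.
    near=> t'; have te' : `|t' - t0| < e by near: t'.
    by have [_ _ [_ [_ -> _ _]]] := box 0 t' norm0 te'.
  (* For small s the transverse coordinates at times t and [t0] agree, hence so do their
     s-derivatives, and at [t0] these vanish with [J t0]. *)
  have eJ : 'D_(J t) Phi (F 0 t) =
      'D_(J t) Phi (F 0 t) ord0 ord0 *: delta_mx ord0 ord0.
    apply: rV_delta0 => i i1.
    have t0e : `|t0 - t0| < e by rewrite subrr normr0.
    have [_ _ [_ [_ _ dPhi0 _]]] := box 0 t0 norm0 t0e.
    have [_ <-] := is_derive_coord _ _ _ _ ord0 i PJ.
    have PJ0 := is_derive_comp (F ^~ t0) Phi 0 1 _ dPhi0 (dJ t0).
    have [_] := is_derive_coord _ _ _ _ ord0 i PJ0.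
    rewrite J0 derive0 mxE => E; rewrite -[RHS]E; apply: near_eq_derive.
    by near=> s; apply: const => //; near: s.
  have eT : 'D_(T t) Phi (F 0 t) =
      'D_(T t) Phi (F 0 t) ord0 ord0 *: delta_mx ord0 ord0.
    apply: rV_delta0 => i i1.
    have [_ <-] := is_derive_coord _ _ _ _ ord0 i PT.
    rewrite -[RHS](derive_cst (Phi (F 0 t0) ord0 i) (t : R) 1); apply: near_eq_derive.
    by near=> t'; apply: const => //; near: t'.
  (* Now [J t] and [T t] are multiples of one vector, the image of the leaf direction of the chart.
     It is not orthogonal to c, because [T t] is not, whereas [J t] is orthogonal to c; so the
     coefficient of [J t] is 0. *)
  rewrite eJ (deriveZ_dir _ _ _ _ dPsi) in BJ.
  rewrite eT (deriveZ_dir _ _ _ _ dPsi) in BT.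
  have : dot c (T t) != 0.
    by rewrite nT oppr_eq0 mulf_neq0 // gt_eqF // sin_gt0_pi.
  rewrite -BT dotZr mulf_eq0 negb_or => /andP[_ cE].
  have := nJ t; rewrite -BJ dotZr => /eqP; rewrite mulf_eq0 (negbTE cE) orbF => /eqP ->.
  by rewrite scale0r.
(* At the second time t0 + d the scalar factor of [J] is - sin t0 sin d (1 + l^2), which is
   nonzero. *)
pose d := e / 2.
have d0 : 0 < d by rewrite divr_gt0.
have dpi : d < pi.
  have : e <= t0 by rewrite /e !ge_min lexx !orbT.
  by rewrite /d; lra.
have /rigid : `|(t0 + d) - t0| < e.
  by rewrite addrC addKr gtr0_norm // /d; lra.
have s0 : 0 < sin t0 by rewrite sin_gt0_pi // t00.
have sd : 0 < sin d by rewrite sin_gt0_pi // d0.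
rewrite /J cosD sinD; move/eqP; rewrite scaler_eq0 => /orP[|/eqP //].
have -> : cos t0 = - (l * sin t0) by lra.
have -> : - (l * sin t0) * cos d - sin t0 * sin d +
   l * (sin t0 * cos d + - (l * sin t0) * sin d) =
   - (sin t0 * sin d * (1 + l ^+ 2)) by ring.
rewrite oppr_eq0 gt_eqF // !mulr_gt0 // ltr_pwDl // sqr_ge0.
Unshelve. all: by end_near. Qed.

(** * The contact condition *)

(** The Gram determinant of p and c is 1 - (cos r)^2 = (sin r)^2, which is positive. *)
Lemma rank_pole_point {R : realType} (c p : 'rV[R]_5) (r : R) :
  0 < r < pi -> dot p p = 1 -> dot c c = 1 -> dot c p = cos r ->
  row_free (col_mx p c).
Proof.
move=> /sin_gt0_pi s0 p1 c1 cp.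
apply: inj_row_free => a; rewrite -[a]hsubmxK mul_row_col.
rewrite (mx11_scalar (lsubmx a)) (mx11_scalar (rsubmx a)) !mul_scalar_mx.
set s := lsubmx a 0 0; set t := rsubmx a 0 0 => st.
have E1 : s + t * cos r = 0.
  by have := dot0 p; rewrite -st dotDr !dotZr p1 (dotC p c) cp mulr1.
have E2 : s * cos r + t = 0.
  by have := dot0 c; rewrite -st dotDr !dotZr c1 cp mulr1.
have : t * sin r ^+ 2 = 0.
  rewrite sin2cos2.
  have -> : t * (1 - cos r ^+ 2) = (s * cos r + t) - cos r * (s + t * cos r) by ring.
  by rewrite E1 E2 mulr0 subrr.
move/eqP; rewrite mulf_eq0 expf_eq0 (gt_eqF s0) orbF => /eqP t0.
have -> : s = 0 by rewrite -E1 t0 mul0r addr0.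
by rewrite t0 !raddf0 row_mx0.
Qed.

Theorem theorem5 (R : realType) (c : 'rV[R]_5) (r : R)
    (v : 'rV[R]_5 -> 'rV[R]_5)
    (hc : S4 c) (hr : 0 < r < pi)
    (hN : ~ is_great_sphere (geodesic_sphere c r))
    (hv : smooth_unit_field c r v)
    (hbif : bifoliating c r v) :
  contact_form (geodesic_sphere c r) (fun p w => dot (v p) w).
Proof.
have cr0 : cos r != 0.
  by apply/eqP => cr0; apply: hN; exact: geodesic_sphere_pi2_great.
have [sv vtan] := hv; set N := geodesic_sphere c r in sv vtan *.
have Nc q : N q -> dot c q = cos r by exact: geodesic_sphere_dot.
move=> D W psi phi oD [Z oZ WE] dif x Dx.
have [spsi _ psiW _ _] := dif.
have psiN y : D y -> N (psi y) by move=> /psiW; rewrite WE => -[].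
have [U0 [g [oU0 U0x sg psig]]] := spsi x Dx.
pose U := D `&` U0.
have oU : open U by exact: openI.
have Ux : U x by [].
have gE y : U y -> psi y = g y by move=> Uy; apply: psig; rewrite inE.
have gN y : U y -> N (g y) by move=> Uy; rewrite -gE //; exact: psiN Uy.1.
(* The field matters only on the sphere; derivatives are taken of its local extension [h], and those
   of [psi] through [g]. *)
have [U1 [h [oU1 U1x sh vh]]] := sv (psi x) (psiN x Dx).
have dg y : U y -> differentiable g y by move=> Uy; apply: (sg 1).1; exact: Uy.2.
have dh : differentiable h (g x) by apply: (sh 1).1; rewrite -gE.
have nU : \forall y \near x, U y by exact: open_nbhs_nbhs.
have nU1 : \forall y \near x, U1 (g y).
  have cg : {for x, continuous g} by exact/differentiable_continuous/dg.
  by apply: cg; apply: open_nbhs_nbhs; rewrite -gE.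
have hE y : U y -> U1 (g y) -> v (g y) = h (g y).
  by move=> Uy U1y; apply: vh; rewrite inE; split=> //; exact: gN.
have U1gx : U1 (g x) by rewrite -gE.
pose p := g x; pose V := h p.
have Vp : V = v p by rewrite /V /p hE.
have Np : N p by exact: gN.
have mxd (k : 'rV[R]_3 -> 'rV[R]_5) : differentiable k x ->
    exists M : 'M[R]_(3, 5), forall u, is_derive x u k (u *m M).
  move=> dk; exists (lin1_mx ('d k x)) => u; rewrite mul_rV_lin1 -deriveE //.
  exact/derivableP/diff_derivable.
have dhg : differentiable (h \o g) x by apply: differentiable_comp => //; exact: dg.
have [[A Dg] [B Dh]] := (mxd g (dg x Ux), mxd (h \o g) dhg).
pose alpha (q w : 'rV[R]_5) := dot (v q) w.
(* Schwarz's theorem removes the second derivatives of the parametrization. *)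
have dform u w : ext_d (pullback psi alpha) x u w =
    dot (u *m B) (w *m A) - dot (w *m B) (u *m A).
  have half a b : 'D_a (fun y => pullback psi alpha y b) x =
      dot V ('D_a (fun y => 'D_b g y) x) + dot (a *m B) (b *m A).
    have Hb : is_derive x a (fun y => 'D_b g y) ('D_a (fun y => 'D_b g y) x).
      apply: derivableP; apply: diff_derivable.
      by have [_ H] := sg 2; exact: (H b).1.
    have [_ E] := is_derive_dot _ _ _ _ _ _ (Dh a) Hb.
    have [_ <-] := Dg b.
    transitivity ('D_a (fun y => dot ((h \o g) y) ('D_b g y)) x); last exact: E.
    apply: near_eq_derive.
    near=> y.
    have Uy : U y by near: y.
    have U1y : U1 (g y) by near: y.
    rewrite /pullback /alpha (gE y Uy) (hE y Uy U1y); congr dot; apply: near_eq_derive.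
    by apply: filterS (open_nbhs_nbhs (conj oU Uy)); exact: gE.
  rewrite /ext_d (half u w) (half w u).
  rewrite (mixed_derivatives_rV U0 g x u w oU0 U0x (sg 2)).
  by rewrite opprD addrACA subrr add0r.
apply: contrapT => nex.
(* A parametrization is an immersion: a smooth extension of [phi] is a left inverse of [psi] near
   x. *)
have fA : row_free A.
  apply: inj_row_free => u du.
  have [F [G ext]] := diffeo_local_extension _ _ _ _ x dif Dx.
  have [_ GFx dF dG] := nbhs_singleton ext Dx.
  have extD : \forall y \near x, psi y = F y /\ y = G (F y).
    by apply: filterS2 nU ext => y Uy /(_ Uy.1)[-> ->].
  have <- : 'D_('D_u F x) G (F x) = u.
    apply: (derive_left_inverse F G id x u) => //.
    by apply: filterS extD => y [].
  suff -> : 'D_u F x = 0 by rewrite derive0.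
  have [_ Dgu] := Dg u; rewrite -du -Dgu; apply: near_eq_derive.
  by apply: filterS2 nU extD => y Uy [<- _]; exact: gE.
have [l [u [u0 uB]]] : exists l (u : 'rV[R]_3), u != 0 /\ u *m B = l *: (u *m A).
  (* The conditions on [A] and [B] are the derivatives of |g|^2 = 1, (c, g) = cos r, |h g|^2 = 1,
     (c, h g) = 0 and (g, h g) = 0; the last condition is the assumed vanishing of the 3-form. *)
  apply: (eigenvector_of_degenerate_form A B p c V).
  - exact: fA.
  - exact: (rank_pole_point c p r hr Np.1 hc (Nc p Np)).
  - by rewrite Vp; exact: (vtan p Np).1.1.
  - by rewrite Vp; exact: (vtan p Np).1.2.
  - by rewrite Vp; exact: (vtan p Np).2.
  - move=> u; have gg : \forall y \near x, dot (g y) (g y) = 1.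
      by apply: filterS nU => y Uy; exact: (gN y Uy).1.
    have /eqP := derive_dot_near_const _ _ _ _ _ _ _ (Dg u) (Dg u) gg.
    by rewrite -/p (dotC (u *m A)) -mulr2n mulrn_eq0 => /eqP.
  - move=> u; have := derive_dot_near_const (cst c) g x u _ _ (cos r)
      (is_derive_cst c x u) (Dg u).
    rewrite [dot 0 _]dotC dot0 addr0; apply.
    by apply: filterS nU => y Uy; exact: Nc (gN y Uy).
  - move=> u; have hh : \forall y \near x, dot ((h \o g) y) ((h \o g) y) = 1.
      apply: filterS2 nU nU1 => y Uy U1y.
      by rewrite /= -hE //; exact: (vtan _ (gN y Uy)).2.
    have /eqP := derive_dot_near_const _ _ _ _ _ _ _ (Dh u) (Dh u) hh.
    by rewrite -[(h \o g) x]/V (dotC (u *m B)) -mulr2n mulrn_eq0 => /eqP.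
  - move=> u; have := derive_dot_near_const (cst c) _ x u _ _ 0
      (is_derive_cst c x u) (Dh u).
    rewrite [dot 0 _]dotC dot0 addr0; apply.
    apply: filterS2 nU nU1 => y Uy U1y.
    by rewrite /= -hE //; exact: (vtan _ (gN y Uy)).1.2.
  - move=> u; have := derive_dot_near_const g _ x u _ _ 0 (Dg u) (Dh u).
    rewrite -/p -[(h \o g) x]/V (dotC _ V) => H; apply/eqP.
    rewrite -addr_eq0 H //; apply: filterS2 nU nU1 => y Uy U1y.
    by rewrite /= -hE //; exact: (vtan _ (gN y Uy)).1.1.
  - move=> u1 u2 u3; apply/eqP; apply: contrapT => /negP ne; apply: nex.
    exists u1, u2, u3; move: ne; rewrite /wedge12 -/alpha !dform.
    have pb u : pullback psi alpha x u = dot V (u *m A).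
      have [_ <-] := Dg u; rewrite /pullback /alpha (gE x Ux) -/p -Vp; congr dot.
      by apply: near_eq_derive; apply: filterS nU; exact: gE.
    by rewrite !pb.
(* A curve on the sphere with velocity [u *m A], along which the field has derivative [u *m B], that
   is l times this velocity. *)
pose sigma (s : R) := psi (x + s *: u).
have cl : {for 0, continuous (fun s : R => x + s *: u)}.
  apply/differentiable_continuous/derivable1_diffP.
  by have [] := is_derive_line x u 0.
have nUl : \forall s \near (0 : R), U (x + s *: u).
  by apply: cl; rewrite scale0r addr0.
have nU1l : \forall s \near (0 : R), U1 (g (x + s *: u)).
  by apply: (cl [set y | U1 (g y)]); rewrite scale0r addr0.
have along (k : 'rV[R]_3 -> 'rV[R]_5) (d : 'rV[R]_5) : differentiable k x ->
    is_derive x u k d -> is_derive (0 : R) 1 (fun s : R => k (x + s *: u)) d.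
  move=> dk [_ <-]; have := is_derive_comp (fun s : R => x + s *: u) k 0 1 u _
    (is_derive_line x u 0).
  by rewrite scale0r addr0; apply.
have w0 : u *m A = 0.
  apply: (rays_no_focal_point c r v sigma (u *m A) l hbif.1 cr0).
  - by move=> q Nq; split; [exact: Nc|exact: (vtan q Nq).1.2].
  - by near=> s; apply: psiN; have [] : U (x + s *: u) by near: s.
  - apply: near_eq_is_derive (along g _ (dg x Ux) (Dg u)).
    by near=> s; rewrite /sigma gE //; near: s.
  - rewrite -uB; apply: near_eq_is_derive (along (h \o g) _ dhg (Dh u)).
    near=> s; rewrite /sigma /= gE; last by near: s.
    by rewrite hE //; near: s.
by move/eqP: u0; apply; apply: (row_free_inj fA); rewrite w0 mul0mx.
Unshelve. all: by end_near. Qed.
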